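(* Let $h_1$, $k$ and $n$ be positive integers. An $\mathrm{ILS}(n;h_1^k)$ exists (i) for $k=1$ if and only if $n=h_1$ or $n\ge 2h_1$; (ii) for $k=2$ if and only if $n\ge 3h_1$; (iii) for $k\ge 3$ if and only if $n\ge kh_1$.
   Context: A latin square of order $n$ is an $n\times n$ array filled with symbols from $\{1,\dots,n\}$ such that each symbol occurs exactly once in every row and every column. A subsquare of order $m$ is an $m\times m$ subarray (given by a set of $m$ rows and a set of $m$ columns, not necessarily consecutive) which is itself a latin square of order $m$ on some set of $m$ symbols. Subsquares are disjoint if they share no rows, no columns and no symbols. An $\mathrm{ILS}(n;h_1^k)$ is a (completely filled) latin square of order $n$ with $k$ pairwise disjoint subsquares, each of order $h_1$. *)

(* Defs.v *)
From mathcomp Require Import all_boot all_algebra.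
Set Implicit Arguments.
Unset Strict Implicit.
Unset Printing Implicit Defensive.

(* The rows, the columns and the symbols are all indexed by 'I_n, that is,
   by {0, ..., n-1} instead of {1, ..., n}. *)

(* The R x C subarray of L is a latin square on the symbol set S, of order
   #|S|. *)
Definition latin_subarray n (L : 'M['I_n]_n) (R C S : {set 'I_n}) : Prop :=
  [/\ #|R| = #|S| /\ #|C| = #|S|,
      forall i j, i \in R -> j \in C -> L i j \in S,
      forall i s, i \in R -> s \in S -> exists! j, j \in C /\ L i j = s
    & forall j s, j \in C -> s \in S -> exists! i, i \in R /\ L i j = s].

Definition latin_square n (L : 'M['I_n]_n) : Prop :=
  (forall i s, exists! j, L i j = s) /\ (forall j s, exists! i, L i j = s).

Record subarray n := Subarray {
  sub_rows : {set 'I_n};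
  sub_cols : {set 'I_n};
  sub_syms : {set 'I_n} }.

Definition is_subsquare n (L : 'M['I_n]_n) (m : nat) (B : subarray n) : Prop :=
  #|sub_syms B| = m /\
  latin_subarray L (sub_rows B) (sub_cols B) (sub_syms B).

Definition disjoint_subarrays n (A B : subarray n) : Prop :=
  [/\ [disjoint sub_rows A & sub_rows B],
      [disjoint sub_cols A & sub_cols B]
    & [disjoint sub_syms A & sub_syms B]].

(* L is an ILS(n; h^k). *)
Definition is_ILS n (h k : nat) (L : 'M['I_n]_n) : Prop :=
  latin_square L /\
  exists B : 'I_k -> subarray n,
    (forall a, is_subsquare L h (B a)) /\
    (forall a b, a != b -> disjoint_subarrays (B a) (B b)).

Definition ILS_exists (n h k : nat) : Prop :=
  exists L : 'M['I_n]_n, is_ILS h k L.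

(* Main.v *)
Require Import Defs.
From mathcomp Require Import all_boot all_order all_algebra.
From mathcomp Require Import zify ring.
Set Implicit Arguments.
Unset Strict Implicit.
Unset Printing Implicit Defensive.
Import GRing.Theory Num.Theory.

(* Existence: let C be a set of classes with sizes p c adding up to n, and let
   O a b c count how often symbols of class c are to occur in the cells of row
   class a and column class b. If every line of O has the sum prescribed by p,
   then O is the amalgamation of a latin square of order n: rows, columns and
   symbols are split one kind at a time, each split being a factorization of a
   nonnegative integer matrix with row sums d u and column sums d v into d
   matrices with row sums u and column sums v. A class c with
   O c c c = (p c)^2 yields a subsquare.

   For k >= 3 it thus suffices, writing n = k' h + r with r < h and k <= k', to
   give such an O with k' classes of size h and one of size r. It is
   h r times an idempotent square of order k' + 1 plus h (h - r) times one of
   order k'; idempotent squares exist in every order at least 3.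

   Necessity: in a row that misses a subsquare, the symbols of the subsquare lie
   outside its columns. *)

(** * Splitting integer matrices *)

Section SupplyDemand.
Local Open Scope ring_scope.
Variables A B : finType.
Implicit Types (u : A -> int) (v : B -> int) (W : A -> B -> nat).

(* Slack of the Hall-type condition for the sources R and the sinks S. *)
Definition cut u v W (R : {set A}) (S : {set B}) : int :=
  \sum_b (b \in S)%:Z * v b
  + \sum_a \sum_b ((a \in R) && (b \notin S))%:Z * (W a b)%:Z
  - \sum_a (a \in R)%:Z * u a.

Lemma sum_delta (I : finType) (i : I) (F : I -> int) :
  \sum_j F j * (j == i)%:Z = F i.
Proof.
rewrite (bigD1 i) //= eqxx mulr1 big1 ?addr0 // => j /negPf->.
by rewrite mulr0.
Qed.

Lemma sum_delta2 (F : A -> B -> int) a b :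
  \sum_x \sum_y F x y * ((x == a) && (y == b))%:Z = F a b.
Proof.
rewrite -[RHS](sum_delta a (F^~ b)); apply: eq_bigr => x _.
rewrite -(sum_delta b (F x)) mulr_suml; apply: eq_bigr => y _.
by rewrite -mulrA -PoszM mulnb andbC.
Qed.

Lemma cut_delete u v W a b R S : (0 < W a b)%N ->
  cut u v (fun x y => W x y - ((x == a) && (y == b)))%N R S
  = cut u v W R S - ((a \in R) && (b \notin S))%:Z.
Proof.
move=> W_gt0; rewrite /cut -[in RHS](sum_delta2 (fun x y =>
  ((x \in R) && (y \notin S))%:Z)).
rewrite [RHS]addrAC; congr (_ - _); rewrite -addrA; congr (_ + _).
rewrite -sumrB; apply: eq_bigr => x _; rewrite -sumrB; apply: eq_bigr => y _.
rewrite -mulrBr subzn //; case: eqP => [->|//]; case: eqP => [->|//].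
exact: W_gt0.
Qed.

(** Lowering [u a] and [v b] changes the slack by [(a \in R) - (b \in S)]; removing the unit takes
    off a further [(a \in R) && (b \notin S)]. *)
Lemma cut_use u v W a b R S : (0 < W a b)%N ->
  cut (fun x => u x - (x == a)%:Z) (fun y => v y - (y == b)%:Z)
      (fun x y => W x y - ((x == a) && (y == b)))%N R S
  = cut u v W R S - ((a \notin R) && (b \in S))%:Z.
Proof.
move=> W_gt0; pose W' x y := (W x y - ((x == a) && (y == b)))%N.
have Eu : \sum_x (x \in R)%:Z * (u x - (x == a)%:Z)
    = \sum_x (x \in R)%:Z * u x - (a \in R)%:Z.
  by under eq_bigr do rewrite mulrBr; rewrite sumrB sum_delta.
have Ev : \sum_y (y \in S)%:Z * (v y - (y == b)%:Z)
    = \sum_y (y \in S)%:Z * v y - (b \in S)%:Z.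
  by under eq_bigr do rewrite mulrBr; rewrite sumrB sum_delta.
transitivity (cut u v W' R S - (b \in S)%:Z + (a \in R)%:Z).
  by rewrite /cut Eu Ev; ring.
by rewrite cut_delete //; case: (a \in R); case: (b \in S) => /=; ring.
Qed.

(* The extra W a b on the left: an edge from R minus R' to S' minus S crosses
   the cut (R, S) but neither of the cuts on the left-hand side. *)
Lemma cut_submodular u v W R S R' S' a b :
    (a \in R :\: R') && (b \in S' :\: S) ->
  cut u v W (R :&: R') (S :&: S') + cut u v W (R :|: R') (S :|: S') + (W a b)%:Z
  <= cut u v W R S + cut u v W R' S'.
Proof.
move=> ab; have bool_modular (x y : bool) : x%:Z + y%:Z = (x && y)%:Z + (x || y)%:Z.
  by case: x; case: y.
have Eu : \sum_a (a \in R)%:Z * u a + \sum_a (a \in R')%:Z * u a =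
    \sum_a (a \in R :&: R')%:Z * u a + \sum_a (a \in R :|: R')%:Z * u a.
  by rewrite -!big_split; apply: eq_bigr => x _ /=;
    rewrite -!mulrDl !inE bool_modular.
have Ev : \sum_b (b \in S)%:Z * v b + \sum_b (b \in S')%:Z * v b =
    \sum_b (b \in S :&: S')%:Z * v b + \sum_b (b \in S :|: S')%:Z * v b.
  by rewrite -!big_split; apply: eq_bigr => x _ /=;
    rewrite -!mulrDl !inE bool_modular.
pose w (R : {set A}) (S : {set B}) :=
  \sum_a \sum_b ((a \in R) && (b \notin S))%:Z * (W a b)%:Z.
suff Ew : w (R :&: R') (S :&: S') + w (R :|: R') (S :|: S') + (W a b)%:Z
    <= w R S + w R' S'.
  by rewrite /cut -!/(w _ _); lia.
rewrite -(sum_delta2 (fun x y => (W x y)%:Z) a b) -!big_split.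
apply: ler_sum => x _; rewrite -!big_split; apply: ler_sum => y _ /=.
rewrite [_ * (_ && _)%:Z]mulrC -!mulrDl; apply: ler_wpM2r => //.
have : ((x == a) && (y == b)) ==> (x \in R :\: R') && (y \in S' :\: S).
  by apply/implyP => /andP[/eqP-> /eqP->].
rewrite !inE; case: (_ && (y == b)); case: (x \in R); case: (x \in R');
  by case: (y \in S); case: (y \in S').
Qed.

(* Take a cell with W a b > 0. If the cut condition survives neither deleting one
   unit of W a b nor using it, then two tight cuts contradict submodularity. *)
Lemma supply_demand u v W :
    \sum_a u a = \sum_b v b -> (forall R S, 0 <= cut u v W R S) ->
  exists2 F : A -> B -> nat, forall a b, (F a b <= W a b)%N
    & (forall a, \sum_b (F a b)%:Z = u a) /\ (forall b, \sum_a (F a b)%:Z = v b).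
Proof.
move: {2}(\sum_a \sum_b W a b)%N (leqnn (\sum_a \sum_b W a b)%N) => N.
elim: N u v W => [|N IHN] u v W leWN Euv cut_ge0.
  have W0 a b : W a b = 0%N.
    move: leWN; rewrite leqn0 sum_nat_eq0 => /forallP/(_ a)/implyP/(_ isT).
    by rewrite sum_nat_eq0 => /forallP/(_ b)/implyP/(_ isT)/eqP.
  have cut0 R S : cut u v W R S =
      \sum_b (b \in S)%:Z * v b - \sum_a (a \in R)%:Z * u a.
    rewrite /cut [X in _ + X - _]big1 ?addr0 // => a _.
    by rewrite big1 // => b _; rewrite W0 mulr0.
  have sum1 (I : finType) (i : I) (F : I -> int) :
      \sum_j (j \in [set i])%:Z * F j = F i.
    by rewrite -[RHS](sum_delta i); apply: eq_bigr => j _; rewrite inE mulrC.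
  have sumC1 (I : finType) (i : I) (F : I -> int) :
      \sum_j (j \in [set~ i])%:Z * F j = \sum_j F j - F i.
    rewrite -(sum_delta i F) -sumrB; apply: eq_bigr => j _; rewrite !inE.
    by case: (j == i); rewrite ?mul1r ?mulr1 ?mul0r ?mulr0 ?subrr ?subr0.
  have sum0 (I : finType) (F : I -> int) : \sum_j (j \in set0)%:Z * F j = 0.
    by rewrite big1 // => j _; rewrite inE mul0r.
  have sumT (I : finType) (F : I -> int) :
      \sum_j (j \in setT)%:Z * F j = \sum_j F j.
    by apply: eq_bigr => j _; rewrite inE mul1r.
  (* With [W] zero, a singleton and its complement bound [u a] from both sides, the totals of [u]
     and [v] being equal. *)
  have u0 a : u a = 0.
    have := cut_ge0 [set a] set0; have := cut_ge0 [set~ a] setT.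
    by rewrite !cut0 sumT sum0 sumC1 sum1 Euv; lia.
  have v0 b : v b = 0.
    have := cut_ge0 setT [set~ b]; have := cut_ge0 set0 [set b].
    by rewrite !cut0 sumT sum0 sumC1 sum1 Euv; lia.
  by exists (fun _ _ => 0%N) => //; split=> x; rewrite ?u0 ?v0 big1.
have [[a [b W_gt0]] | W0] : (exists a b, 0 < W a b)%N \/
    (forall a b, W a b = 0%N).
- have [/existsP[a /existsP[b ?]]|/existsPn W0] :=
    boolP [exists a, exists b, (0 < W a b)%N]; [by left; exists a, b | right].
  by move=> a b; move/existsPn/(_ b): (W0 a); rewrite lt0n negbK => /eqP.
- pose W' x y := (W x y - ((x == a) && (y == b)))%N.
  have W'W x y : (W' x y <= W x y)%N by apply: leq_subr.
  have EW : (\sum_x \sum_y W x y = (\sum_x \sum_y W' x y).+1)%N.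
    apply/eqP; rewrite -eqz_nat -addn1 PoszD !(big_morph Posz PoszD erefl).
    under eq_bigr do rewrite (big_morph Posz PoszD erefl).
    under [X in _ == X + _]eq_bigr do rewrite (big_morph Posz PoszD erefl).
    rewrite -[1%:Z](sum_delta2 (fun _ _ => 1) a b) -big_split; apply/eqP.
    apply: eq_bigr => x _; rewrite -big_split; apply: eq_bigr => y _ /=.
    rewrite /W' mul1r -PoszD subnK //.
    by case: eqP => [->|//]; case: eqP => [->|//].
  have {EW}leWN : (\sum_x \sum_y W' x y <= N)%N by rewrite EW in leWN.
  have [/forallP del|/forallPn] :=
    boolP [forall R, forall S, 0 <= cut u v W' R S].
    have [|F leF EF] := IHN u v W' leWN Euv.
      by move=> R S; exact: (forallP (del R)).
    by exists F => // x y; apply: leq_trans (W'W x y).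
  move=> [R /forallPn[S delRS]].
  pose u' x := u x - (x == a)%:Z; pose v' y := v y - (y == b)%:Z.
  have [/forallP use|/forallPn] :=
    boolP [forall R, forall S, 0 <= cut u' v' W' R S].
    have [||F leF [Eu Ev]] := IHN u' v' W' leWN.
    - rewrite !sumrB Euv; congr (_ - _).
      under eq_bigr do rewrite -[Posz _]mul1r.
      by under [RHS]eq_bigr do rewrite -[Posz _]mul1r; rewrite !sum_delta.
    - by move=> R' S'; exact: (forallP (use R')).
    exists (fun x y => F x y + ((x == a) && (y == b)))%N.
      move=> x y; move: (leF x y); rewrite /W'.
      by case: eqP => [->|//]; case: eqP => [->|//] /=; lia.
    split=> [x|y]; under eq_bigr do rewrite PoszD; rewrite big_split /=.
      rewrite Eu /u' -[X in _ + X = _](_ : (x == a)%:Z = _) ?subrK //.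
      rewrite -[LHS](sum_delta b (fun=> (x == a)%:Z)); apply: eq_bigr => y _.
      by rewrite -PoszM mulnb.
    rewrite Ev /v' -[X in _ + X = _](_ : (y == b)%:Z = _) ?subrK //.
    rewrite -[LHS](sum_delta a (fun=> (y == b)%:Z)); apply: eq_bigr => x _.
    by rewrite -PoszM mulnb andbC.
  move=> [R' /forallPn[S' useRS]].
  move: delRS useRS; rewrite cut_delete // cut_use //.
  have := cut_ge0 R S; have := cut_ge0 R' S'.
  have := cut_ge0 (R :&: R') (S :&: S'); have := cut_ge0 (R :|: R') (S :|: S').
  have := @cut_submodular u v W R S R' S' a b; rewrite !inE.
  case: (a \in R); case: (b \in S); rewrite /= ?subr0; lia.
by apply: (IHN u v W) => //; rewrite big1 // => a _; rewrite big1.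
Qed.
End SupplyDemand.

(** The rational matrix [W / d] has these line sums, which forces the cut condition: multiplied by
    [d], the slack is a sum over cells of [W a b] times 0, 1 or [d - 1]. *)
Lemma balanced_factor (A B : finType) (d : nat) (u : A -> nat) (v : B -> nat)
    (W : A -> B -> nat) :
    0 < d -> (forall a, \sum_b W a b = d * u a) ->
    (forall b, \sum_a W a b = d * v b) ->
  exists2 F : A -> B -> nat, forall a b, F a b <= W a b
    & (forall a, \sum_b F a b = u a) /\ (forall b, \sum_a F a b = v b).
Proof.
move=> d_gt0 rowW colW.
have PoszS (I : finType) (G : I -> nat) :
    ((\sum_i G i)%N%:Z = \sum_i (G i)%:Z)%R by exact: (big_morph Posz PoszD).
have [||F leF [Eu Ev]] := @supply_demand A B (Posz \o u) (Posz \o v) W.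
- rewrite /= -!PoszS; congr Posz; apply/eqP.
  rewrite -(eqn_pmul2l d_gt0) !big_distrr /=.
  under eq_bigr do rewrite -rowW; rewrite exchange_big /=.
  by apply/eqP/eq_bigr => b _; rewrite colW.
- move=> R S; rewrite -(pmulr_rge0 _ (_ : 0 < d%:Z)%R) //.
  rewrite /cut mulrBr mulrDr !mulr_sumr.
  have -> : (\sum_b d%:Z * ((b \in S)%:Z * (Posz \o v) b)
      = \sum_a \sum_b (b \in S)%:Z * (W a b)%:Z)%R.
    rewrite exchange_big; apply: eq_bigr => b _ /=.
    by rewrite -mulr_sumr -PoszS colW PoszM mulrCA.
  have -> : (\sum_a d%:Z * ((a \in R)%:Z * (Posz \o u) a)
      = \sum_a \sum_b (a \in R)%:Z * (W a b)%:Z)%R.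
    apply: eq_bigr => a _ /=.
    by rewrite -mulr_sumr -PoszS rowW PoszM mulrCA.
  rewrite -big_split -sumrB; apply: sumr_ge0 => a _ /=.
  rewrite mulr_sumr -big_split -sumrB; apply: sumr_ge0 => b _ /=.
  by case: (a \in R); case: (b \in S) => /=; nia.
by exists F => //; split=> [a|b]; apply/eqP; rewrite -eqz_nat PoszS ?Eu ?Ev.
Qed.

(** One factor is peeled off per element of [s]; the remainder has line sums [u] and [v] times the
    length of the rest. *)
Lemma split_matrix (T : eqType) (A B : finType) (s : seq T)
    (u : A -> nat) (v : B -> nat) (W : A -> B -> nat) :
    uniq s -> (forall a, \sum_b W a b = size s * u a) ->
    (forall b, \sum_a W a b = size s * v b) ->
  exists W' : T -> A -> B -> nat,
    (forall a b, \sum_(t <- s) W' t a b = W a b) /\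
    {in s, forall t, (forall a, \sum_b W' t a b = u a) /\
                     (forall b, \sum_a W' t a b = v b)}.
Proof.
elim: s W => [|t s IHs] W /=.
  move=> _ rowW _; exists (fun _ => W); split=> // a b; rewrite big_nil.
  by move/eqP: (rowW a); rewrite sum_nat_eq0 => /forallP/(_ b)/eqP.
case/andP=> t_s uniq_s rowW colW.
have [F leF [Eu Ev]] := balanced_factor (ltn0Sn _) rowW colW.
have [|a|b|W' [sumW' W'P]] := IHs (fun a b => W a b - F a b) => //.
- by rewrite sumnB // rowW Eu mulSn addKn.
- by rewrite sumnB // colW Ev mulSn addKn.
exists (fun t' => if t' == t then F else W' t'); split=> [a b|t'].
  rewrite big_cons eqxx -[RHS](subnKC (leF a b)) -sumW'; congr (_ + _).
  by apply: eq_big_seq => t' t'_s; case: eqP t_s => // <-; rewrite t'_s.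
by rewrite inE; case: eqP => // _ /W'P.
Qed.

(** * Unfolding an outline square into a latin square *)

Lemma split_classes (T C A B : finType) (g : T -> C) (p : C -> nat)
    (u : C -> A -> nat) (v : C -> B -> nat) (W : C -> A -> B -> nat) :
    (forall c, #|[pred t | g t == c]| = p c) ->
    (forall c a, \sum_b W c a b = p c * u c a) ->
    (forall c b, \sum_a W c a b = p c * v c b) ->
  exists W' : T -> A -> B -> nat,
    [/\ forall c a b, \sum_(t | g t == c) W' t a b = W c a b,
        forall t a, \sum_b W' t a b = u (g t) a
      & forall t b, \sum_a W' t a b = v (g t) b].
Proof.
move=> cardp rowW colW.
(* Classes are split independently; an element [t] reads only the family chosen for [g t]. *)
have /fin_all_exists[W' W'P] c : exists W' : T -> A -> B -> nat,
    (forall a b, \sum_(t | g t == c) W' t a b = W c a b) /\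
    (forall t, g t = c -> (forall a, \sum_b W' t a b = u c a) /\
                          (forall b, \sum_a W' t a b = v c b)).
  have [||| W' [sumW' W'P]] := @split_matrix _ _ _ (enum [pred t | g t == c])
    (u c) (v c) (W c); rewrite -?cardE ?cardp ?enum_uniq //.
  exists W'; split=> [a b|t gt]; first by rewrite -sumW' big_enum.
  by apply: W'P; rewrite mem_enum inE gt.
exists (fun t => W' (g t) t); split=> [c a b|t|t].
- by rewrite -(W'P c).1; apply: eq_bigr => t /eqP->.
- by have [_ /(_ t erefl)[]] := W'P (g t).
- by have [_ /(_ t erefl)[]] := W'P (g t).
Qed.

Lemma sum_classes (T C : finType) (g : T -> C) (F : T -> nat) :
  \sum_t F t = \sum_c \sum_(t | g t == c) F t.
Proof. exact: (partition_big g xpredT). Qed.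

(* Splitting the rows, then the columns, then the symbols of an outline square:
   O c c' c'' counts the cells in row class c and column class c' that are to
   receive a symbol of class c''. *)
Lemma outline_square n (C : finType) (g : 'I_n -> C) (p : C -> nat)
    (O : C -> C -> C -> nat) :
    (forall c, #|[pred i | g i == c]| = p c) ->
    (forall a b, \sum_c O a b c = p a * p b) ->
    (forall a c, \sum_b O a b c = p a * p c) ->
    (forall b c, \sum_a O a b c = p b * p c) ->
  exists L : 'M['I_n]_n,
    latin_square L /\ forall i j, 0 < O (g i) (g j) (g (L i j)).
Proof.
move=> cardp O3 O2 O1.
(* [X i b c] counts the cells of row [i] in column class [b] with symbols of class [c]. [Y j i c]
   and [Z s i j] then refine columns and symbols, until all line sums are 1. *)
have [X [sumX X3 X2]] := split_classes (u := fun _ => p) (v := fun _ => p)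
  cardp O3 O2.
have [||Y [sumY Y3 Y1]] := split_classes (u := fun _ _ => 1)
    (v := fun _ => p) (W := fun b i c => X i b c) cardp.
- by move=> b i; rewrite X3 muln1.
- move=> b c; rewrite (sum_classes g) -O1.
  by apply: eq_bigr => a _; rewrite sumX.
have [||Z [sumZ Z2 Z1]] := split_classes (u := fun _ _ => 1)
    (v := fun _ _ => 1) (W := fun c i j => Y j i c) cardp.
- move=> c i; rewrite (sum_classes g) muln1 -(X2 i).
  by apply: eq_bigr => b _; rewrite sumY.
- by move=> c j; rewrite Y1 muln1.
have Z3 i j : \sum_s Z s i j = 1.
  rewrite (sum_classes g) -(Y3 j i); apply: eq_bigr => c _.
  exact: sumZ.
have sum1P (T : finType) (F : T -> nat) : \sum_t F t = 1 ->
    exists! t, 0 < F t.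
  move/eqP/sum_nat_eq1 => [t [_ Ft F0]].
  exists t; split=> [|t']; first by rewrite Ft.
  by apply: contraTeq; rewrite eq_sym => /F0->.
pose P s i j := 0 < Z s i j.
have PL i j : exists s, P s i j by have [s []] := sum1P _ _ (Z3 i j); exists s.
pose L : 'M['I_n]_n := (\matrix_(i, j) xchoose (PL i j))%R.
have LP i j s : (L i j = s) <-> 0 < Z s i j.
  rewrite mxE; split=> [<-|Zs]; first exact: (xchooseP (PL i j)).
  have [s' [_ us]] := sum1P _ _ (Z3 i j).
  by rewrite -(us _ Zs) -(us _ (xchooseP (PL i j))).
exists L; split.
  split=> [i s|j s].
  - have [j [Zj uj]] := sum1P _ _ (Z2 s i).
    by exists j; split=> [|j']; rewrite LP //; apply: uj.
  - have [i [Zi ui]] := sum1P _ _ (Z1 s j).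
    by exists i; split=> [|i']; rewrite LP //; apply: ui.
(* An entry of a split is at most the entry it was split from, so positivity of [Z] at a filled cell
   lifts through [Y] and [X] to [O]. *)
have le_class (F : 'I_n -> nat) i : F i <= \sum_(j | g j == g i) F j.
  by rewrite (bigD1 i) //= leq_addr.
move=> i j; have /LP/leq_trans : L i j = L i j by []; apply.
rewrite -sumX; apply: leq_trans (le_class _ i); rewrite -sumY.
by apply: leq_trans (le_class _ j); rewrite -sumZ; apply: (le_class (fun s => _)).
Qed.

(** * From outline squares to incomplete latin squares *)

Section LatinSquare.
Variables (n : nat) (L : 'M['I_n]_n).
Hypothesis latL : latin_square L.

Lemma latin_row_inj i : injective (L i).
Proof.
move=> j j' eqL; have [j0 [_ uniq]] := latL.1 i (L i j).
by rewrite -(uniq j) // -(uniq j').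
Qed.

Lemma latin_col_inj j : injective (L^~ j).
Proof.
move=> i i' eqL; have [i0 [_ uniq]] := latL.2 j (L i j).
by rewrite -(uniq i) // -(uniq i').
Qed.

(** An injective map from a set of size [#|S|] into [S] is onto. *)
Lemma latin_subarray_closed (R C S : {set 'I_n}) :
    #|R| = #|S| -> #|C| = #|S| ->
    (forall i j, i \in R -> j \in C -> L i j \in S) ->
  latin_subarray L R C S.
Proof.
move=> cardR cardC closed.
have onto (D : {set 'I_n}) (f : 'I_n -> 'I_n) s : injective f ->
    #|D| = #|S| -> (forall x, x \in D -> f x \in S) -> s \in S ->
    exists! x, x \in D /\ f x = s.
  move=> injf cardD fDS sS; have : s \in f @: D.
    suff -> : f @: D = S by [].
    apply/eqP; rewrite eqEcard card_imset // cardD leqnn andbT.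
    by apply/subsetP => _ /imsetP[x xD ->]; apply: fDS.
  by case/imsetP=> x xD ->; exists x; split=> // y [_ /injf].
split=> // [i s iR sS|j s jC sS].
  by apply: onto sS => // [|j]; [exact: latin_row_inj | exact: closed].
apply: (onto R (L^~ j)) sS => // [|i iR]; first exact: latin_col_inj.
exact: closed.
Qed.

(** Each column of [B] already has every symbol of [B] in a row of [B], so row [i] has these symbols
    elsewhere. A free [D] lets further columns be excluded. *)
Lemma subsquare_row_bound m (B : subarray n) (D : {set 'I_n}) i :
    is_subsquare L m B -> i \notin sub_rows B ->
    (forall j, L i j \in sub_syms B -> j \notin sub_cols B -> j \in D) ->
  m <= #|D|.
Proof.
move=> [cardS [_ _ _ colB]] iR D_P; rewrite -cardS.
apply: leq_trans (leq_imset_card (L i) D); apply/subset_leq_card/subsetP => s sS.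
have [j [Lij _]] := latL.1 i s; rewrite -Lij imset_f // D_P ?Lij //.
apply: contra iR => jC; have [i' [[i'R Li'j] _]] := colB j s jC sS.
by rewrite (_ : i = i') //; apply: (@latin_col_inj j); rewrite Lij Li'j.
Qed.
End LatinSquare.

Lemma class_map n (C : finType) (p : C -> nat) : \sum_c p c = n ->
  exists g : 'I_n -> C, forall c, #|[pred i | g i == c]| = p c.
Proof.
move=> sum_p; pose T := {c : C & 'I_(p c)}.
have cardT : n = #|{: T}|.
  rewrite card_tagged sumnE big_map big_enum -sum_p /=.
  by apply: eq_bigr => c _; rewrite card_ord.
exists (fun i => tag (enum_val (cast_ord cardT i))) => c.
rewrite -[RHS]card_ord -(card_codom (f := fun x : 'I_(p c) =>
  cast_ord (esym cardT) (enum_rank (Tagged (fun c => 'I_(p c)) x)))); last first.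
  by move=> x y /cast_ord_inj/enum_rank_inj/eqP; rewrite eq_Tagged => /eqP.
apply: eq_card => i; rewrite !inE; apply/eqP/codomP => [<-|[x ->]].
  exists (tagged (enum_val (cast_ord cardT i))).
  have -> : forall t : T, Tagged (fun c => 'I_(p c)) (tagged t) = t by case.
  by rewrite enum_valK cast_ordK.
by rewrite cast_ordKV enum_rankK.
Qed.

(** Cells in row and column class [e a] can hold only symbols of class [e a], so the indices of that
    class span a closed subarray. *)
Lemma outline_ILS n h k (C : finType) (p : C -> nat) (O : C -> C -> C -> nat)
    (e : 'I_k -> C) :
    injective e -> (forall a, p (e a) = h) -> \sum_c p c = n ->
    (forall a b, \sum_c O a b c = p a * p b) ->
    (forall a c, \sum_b O a b c = p a * p c) ->
    (forall b c, \sum_a O a b c = p b * p c) ->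
    (forall a c, 0 < O (e a) (e a) c -> c = e a) ->
  ILS_exists n h k.
Proof.
move=> inj_e pe sum_p O3 O2 O1 diagO.
have [g cardg] := class_map sum_p.
have [L [latL posL]] := outline_square cardg O3 O2 O1.
pose K a := [set i | g i == e a].
have cardK a : #|K a| = h.
  by rewrite -(pe a) -cardg; apply: eq_card => i; rewrite inE.
exists L; split=> //; exists (fun a => Subarray (K a) (K a) (K a)).
split=> [a|a b ab].
  split; rewrite /= ?cardK //; apply: latin_subarray_closed => // i j.
  by rewrite !inE => /eqP gi /eqP gj; apply/eqP/diagO; rewrite -{1}gi -gj.
suff dis : [disjoint K a & K b] by split.
rewrite -setI_eq0; apply/eqP/setP => i; rewrite !inE.
by apply/negbTE; apply: contra ab => /andP[/eqP-> /eqP/inj_e->].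
Qed.

(** Class [true] carries the subsquare. The truncated [m - h] is harmless when [m = 0], as its
    factor [m] vanishes. *)
Lemma ILS_one h m : m = 0 \/ h <= m -> ILS_exists (h + m) h 1.
Proof.
move=> hm; apply: (@outline_ILS _ _ _ bool (fun c => if c then h else m)
  (fun a b c => match a, b, c with
   | true, true, true => h * h
   | true, false, false | false, true, false | false, false, true => h * m
   | false, false, false => m * (m - h)
   | _, _, _ => 0
   end) (fun _ => true)); rewrite ?big_bool //.
- by move=> x y _; rewrite !ord1.
- by case; case; rewrite big_bool /=; nia.
- by case; case; rewrite big_bool /=; nia.
- by case; case; rewrite big_bool /=; nia.
- by move=> _ [].
Qed.

(** * Necessity *)

Lemma ILS_single_bound n h : ILS_exists n h 1 -> n = h \/ 2 * h <= n.
Proof.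
move=> [L [latL [B [/(_ ord0)]]]]; move: (B ord0) => {}B subB _.
have [cardS [[cardR cardC] _ _ _]] := subB.
have cardCC := cardsC (sub_cols B); rewrite cardC cardS card_ord in cardCC.
have [RT|] := eqVneq (sub_rows B) setT.
  by left; rewrite -cardS -cardR RT cardsT card_ord.
rewrite -subTset => /subsetPn[i _ iR]; right.
suff : h <= #|~: sub_cols B| by lia.
by apply: (subsquare_row_bound latL subB iR) => j _; rewrite inE.
Qed.

(** In a row of the first subsquare, symbols of the second avoid the columns of the second, which
    the row misses, and those of the first, whose cells hold symbols of the first. Hence [h] further
    columns are needed. *)
Lemma ILS_pair_bound n h : 0 < h -> ILS_exists n h 2 -> 3 * h <= n.
Proof.
move=> h_gt0 [L [latL [B [subB disB]]]].
have [disR disC disS] := disB ord0 ord_max isT.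
have [cardS0 [[cardR0 cardC0] closed0 _ _]] := subB ord0.
have [cardS1 [[_ cardC1] _ _ _]] := subB ord_max.
have [i iR0] : exists i, i \in sub_rows (B ord0).
  by apply/card_gt0P; rewrite cardR0 cardS0.
have cardU : #|sub_cols (B ord0) :|: sub_cols (B ord_max)| = h + h.
  rewrite cardsU cardC0 cardC1 cardS0 cardS1.
  by move: disC; rewrite -setI_eq0 => /eqP->; rewrite cards0 subn0.
have := cardsC (sub_cols (B ord0) :|: sub_cols (B ord_max)).
rewrite cardU card_ord.
suff : h <= #|~: (sub_cols (B ord0) :|: sub_cols (B ord_max))| by lia.
apply: (subsquare_row_bound latL (subB ord_max) (negbT (disjointFr disR iR0))).
move=> j LS1 jC1; rewrite !inE negb_or jC1 andbT; apply/negP => jC0.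
by rewrite (disjointFr disS (closed0 i j iR0 jC0)) in LS1.
Qed.

(** Double counting of pairs of a row and a subsquare: each row meets at most one. *)
Lemma ILS_bound n h k : ILS_exists n h k -> k * h <= n.
Proof.
move=> [L [latL [B [subB disB]]]].
have -> : k * h = \sum_(a < k) #|sub_rows (B a)|.
  rewrite -[k in LHS]card_ord -sum_nat_const; apply: eq_bigr => a _.
  by have [cardS [[-> _] _ _ _]] := subB a; rewrite cardS.
have -> : \sum_(a < k) #|sub_rows (B a)| =
    \sum_(i < n) \sum_(a < k | i \in sub_rows (B a)) 1.
  rewrite (exchange_big_dep xpredT) //=; apply: eq_bigr => a _.
  by rewrite sum1_card.
rewrite -[n in _ <= n]card_ord -sum1_card; apply: leq_sum => i _.
rewrite sum1_card; apply/card_le1_eqP => a b aB bB; apply/eqP.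
by apply: contraTT aB => /disB[dis _ _]; exact: negbT (disjointFr dis bB).
Qed.

Lemma ILS_fewer n h k k' : k' <= k -> ILS_exists n h k -> ILS_exists n h k'.
Proof.
move=> lek [L [latL [B [subB disB]]]]; exists L; split=> //.
exists (fun a => B (widen_ord lek a)); split=> [a|a b ab] //.
by apply: disB; apply: contra ab => /eqP[/val_inj->].
Qed.

(** * Idempotent squares *)

Definition idempotent_square (T : Type) (q : T -> T -> T) : Prop :=
  [/\ forall x, q x x = x, forall x, injective (q x)
    & forall y, injective (q^~ y)].

Section Halving.
Local Open Scope ring_scope.
Variables (V : zmodType) (t : nat).
Hypothesis V_order : forall x : V, x *+ t.*2.+1 = 0.

(** Multiplication by [t + 1] halves, since [2 * (t + 1)] is one more than [2 * t + 1], which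
    annihilates [V]. *)
Lemma double_half (x : V) : (x *+ t.+1) *+ 2 = x.
Proof. by rewrite -mulrnA muln2 doubleS mulrSr V_order add0r. Qed.

Lemma half_inj : injective (fun x : V => x *+ t.+1).
Proof. by move=> x y /(congr1 (fun z => z *+ 2)); rewrite !double_half. Qed.

Lemma double_inj : injective (fun x : V => x *+ 2).
Proof.
move=> x y /(congr1 (fun z => z *+ t.+1)).
by rewrite -!(mulrnAC _ t.+1) !double_half.
Qed.

Definition mean (x y : V) : V := (x + y) *+ t.+1.

Lemma mean_idempotent : idempotent_square mean.
Proof.
split=> [x|x|y]; first by rewrite /mean -mulr2n mulrnAC double_half.
  by move=> y z /half_inj/addrI.
by move=> x z /half_inj/addIr.
Qed.

(* Prolongation of the mean along the transversal of the cells (x, x + e). *)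
Definition prolonged_mean (e : V) (x y : option V) : option V :=
  match x, y with
  | Some x, Some y => if y == x + e then None else Some (mean x y)
  | Some x, None => Some (mean x (x + e))
  | None, Some y => Some (mean (y - e) y)
  | None, None => None
  end.

(** As [e != 0], the transversal avoids the diagonal. The displaced symbols are the halves of
    [2 x + e], distinct because doubling and halving are injective. *)
Lemma prolonged_mean_idempotent (e : V) :
  e != 0 -> idempotent_square (prolonged_mean e).
Proof.
have [mean_id mean_row mean_col] := mean_idempotent.
move=> e0; split=> [[x|] //=|x|y].
- by rewrite -{1}[x]addr0 (inj_eq (addrI x)) eq_sym (negPf e0) mean_id.
- case: x => [x|] [y|] [z|] //=.
  + by case: eqP => [->|_]; case: eqP => [->|_] // [/mean_row->].
  + by case: eqP => // ne [/mean_row].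
  + by case: eqP => // ne [/mean_row/esym].
  + by move=> [/half_inj]; rewrite ![_ - e + _]addrAC -!mulr2n;
    move=> /addIr/double_inj ->.
- case: y => [y|] [x|] [z|] //=.
  + case: eqP => [->|_]; case: eqP => [E|_] //; first by rewrite (addIr _ E).
    by move=> [/mean_col->].
  + by case: eqP => // ne [/mean_col E]; case: ne; rewrite E subrK.
  + by case: eqP => // ne [/mean_col/esym E]; case: ne; rewrite E subrK.
  + by move=> [/half_inj]; rewrite !addrA -!mulr2n => /addIr/double_inj ->.
Qed.
End Halving.

Lemma idempotent_square_transport (T U : finType) (q : T -> T -> T) :
    #|U| = #|T| -> idempotent_square q ->
  exists q' : U -> U -> U, idempotent_square q'.
Proof.
move=> cardU [q_id q_row q_col].
have [f [g fK gK]] : exists f : U -> T, bijective f.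
  exists (fun x => enum_val (cast_ord cardU (enum_rank x))).
  exists (fun y => enum_val (cast_ord (esym cardU) (enum_rank y))) => x;
    by rewrite enum_valK ?cast_ordK ?cast_ordKV enum_rankK.
exists (fun x y => g (q (f x) (f y))); split=> [x|x y z|y x z].
- by rewrite q_id fK.
- by move=> /(can_inj gK)/q_row/(can_inj fK).
- by move=> /(can_inj gK)/q_col/(can_inj fK).
Qed.

Lemma idempotent_square_exists (T : finType) : 3 <= #|T| ->
  exists q : T -> T -> T, idempotent_square q.
Proof.
move=> cardT; pose t := (#|T|.-1)./2.
have V_order (x : 'I_t.*2.+1) : (x *+ t.*2.+1 = 0)%R.
  by rewrite Zp_mulrn; apply: val_inj; rewrite /= modnMl.
(* An odd order is [2 t + 1], that of the cyclic group. An even order is [2 t + 2] and at least 4,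
   so [t > 0] and 1 is a nonzero choice of [e]. *)
have [oddT|evenT] := boolP (odd #|T|).
  apply: idempotent_square_transport (mean_idempotent V_order).
  by rewrite card_ord /t; lia.
have t_gt0 : 0 < t by rewrite /t; lia.
have e0 : (inZp 1 : 'I_t.*2.+1) != 0%R.
  by apply/eqP => /(congr1 val) /=; rewrite modn_small; lia.
apply: idempotent_square_transport (prolonged_mean_idempotent V_order e0).
by rewrite card_option card_ord /t; lia.
Qed.

(** * Sufficiency *)

Lemma big_option (T : finType) (F : option T -> nat) :
  \sum_c F c = F None + \sum_(c : T) F (Some c).
Proof.
rewrite (bigD1 None) //=; congr (_ + _).
rewrite (reindex_omap Some id) /=; last by case.
by apply: eq_bigl => c; rewrite eqxx.
Qed.

Section HoleOutline.
Variables (k h r : nat).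
Let C := option 'I_k.
Implicit Types (M : 'I_k -> 'I_k -> 'I_k -> bool) (N : C -> C -> C -> bool).

Definition hole_size (c : C) : nat := if c is Some _ then h else r.

(* At (None, None, None) the term h r N would place h r symbols in the r^2 cells
   of the hole, hence the separate case. *)
Definition hole_outline M N (a b c : C) : nat :=
  match a, b, c with
  | Some a', Some b', Some c' => h * (h - r) * M a' b' c' + h * r * N a b c
  | None, None, None => r * r
  | _, _, _ => h * r * N a b c
  end.

(** Keeping [M] and [N] arbitrary lets the other two directions follow by permuting their
    arguments. *)
Lemma hole_outline_sum M N a b : r <= h ->
    (forall a b, \sum_c M a b c = 1) -> (forall a b, \sum_c N a b c = 1) ->
    N None None None ->
  \sum_c hole_outline M N a b c = hole_size a * hole_size b.
Proof.
move=> rh M1 N1 N0; have NN := N1 a b; move: NN; rewrite !big_option.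
case: a => [a|]; case: b => [b|] /=.
- rewrite big_split /= -!big_distrr /= M1; nia.
- rewrite -!big_distrr /=; nia.
- rewrite -!big_distrr /=; nia.
- rewrite N0 -!big_distrr /=; nia.
Qed.
End HoleOutline.

Lemma ILS_many n h k : 0 < h -> 3 <= k -> k * h <= n <= k.+1 * h ->
  ILS_exists n h k.
Proof.
move=> h_gt0 k3 /andP[khn nkh]; pose r := n - k * h.
have rh : r <= h by rewrite /r; lia.
have [|q [q_id q_row q_col]] := @idempotent_square_exists 'I_k.
  by rewrite card_ord.
have [|q' [q'_id q'_row q'_col]] := @idempotent_square_exists (option 'I_k).
  by rewrite card_option card_ord ltnW.
have sum1 (T : finType) (f : T -> T) c : injective f -> \sum_x (f x == c) = 1.
  move=> injf; have [f' fK f'K] := injF_bij injf.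
  rewrite (bigD1 (f' c)) //= f'K eqxx big1 // => x.
  by rewrite -(inj_eq injf) f'K => /negPf->.
have sum1r (T : finType) (c : T) : \sum_x (c == x) = 1.
  by under eq_bigr do rewrite eq_sym; exact: (sum1 _ id).
pose M a b c := q a b == c; pose N a b c := q' a b == c.
have N0 : N None None None by rewrite /N q'_id.
apply: (@outline_ILS n h k (option 'I_k) (hole_size h r) (hole_outline h r M N)
  Some) => //.
- by move=> a b [].
- rewrite big_option /= sum_nat_const card_ord /r; lia.
- by move=> a b; apply: hole_outline_sum => // *; exact: sum1r.
- move=> a c; rewrite -(@hole_outline_sum _ _ _ (fun a c b => M a b c)
    (fun a c b => N a b c)) // => [|a' c'|a' c']; try exact: sum1.
  by apply: eq_bigr => b _; case: a b c => [?|] [?|] [?|].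
- move=> b c; rewrite -(@hole_outline_sum _ _ _ (fun b c a => M a b c)
    (fun b c a => N a b c)) // => [|b' c'|b' c'].
  + by apply: eq_bigr => a _; case: a b c => [?|] [?|] [?|].
  + exact: (sum1 _ (q^~ b')).
  + exact: (sum1 _ (q'^~ b')).
- move=> a [c|]; rewrite /= /M /N q'_id ?q_id; last by rewrite muln0.
  by rewrite (inj_eq Some_inj); case: eqP => [->//|]; rewrite !muln0.
Qed.

Theorem theorem4p3 (h1 k n : nat) (h1_gt0 : 0 < h1) (k_gt0 : 0 < k)
    (n_gt0 : 0 < n) :
  (k = 1 -> (ILS_exists n h1 k <-> (n = h1 \/ 2 * h1 <= n))) /\
  (k = 2 -> (ILS_exists n h1 k <-> 3 * h1 <= n)) /\
  (3 <= k -> (ILS_exists n h1 k <-> k * h1 <= n)).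
Proof.
(* The largest number [n %/ h1] of subsquares is at least 3 and leaves a remainder below [h1];
   surplus subsquares are then forgotten. This serves [k = 2] as well. *)
have many k' : 3 * h1 <= n -> k' <= n %/ h1 -> ILS_exists n h1 k'.
  move=> le3 lek'; apply: (@ILS_fewer _ _ (n %/ h1)) => //.
  apply: ILS_many => //; first by rewrite leq_divRL.
  by rewrite leq_trunc_div ltnW // ltn_ceil.
split=> [->|]; [|split=> [->|k3]].
- split=> [/ILS_single_bound //|n_h].
  have [m -> hm] : exists2 m, n = h1 + m & m = 0 \/ h1 <= m.
    by exists (n - h1); lia.
  exact: ILS_one.
- split=> [/(ILS_pair_bound h1_gt0) //|le3]; apply: many => //.
  by rewrite leq_divRL //; lia.
- split=> [/ILS_bound //|lek]; apply: many; last by rewrite leq_divRL.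
  by apply: leq_trans lek; rewrite leq_pmul2r.
Qed.
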